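(* Let $n,k,\ell$ be integers with $k-1>\ell>1$ and $\ell\leq n-k$. If $G$ is an $n$-vertex $k$-chromatic $\ell$-connected graph, then \[ |E(G)|\geq \binom{k}{2}+\frac{(n-k+1)\ell}{2}, \] and this bound is sharp, in the sense that for all such $n,k,\ell$ there exists an $n$-vertex $k$-chromatic $\ell$-connected graph with exactly $\binom{k}{2}+\left\lceil \frac{(n-k+1)\ell}{2}\right\rceil$ edges.
   Context: All graphs are finite and simple. A graph is $k$-chromatic if its chromatic number is exactly $k$. A graph $G$ is $\ell$-connected if $|V(G)|>\ell$ and any graph obtained by deleting fewer than $\ell$ vertices is connected. $E(G)$ is the edge set of $G$. *)

(* Defs.v *)
From HB Require Import structures.
From mathcomp Require Import all_boot all_order all_algebra.

Set Implicit Arguments.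
Unset Strict Implicit.
Unset Printing Implicit Defensive.

Record sgraph := SGraph {
  vertex :> finType;
  adj : rel vertex;
  adj_sym : symmetric adj;
  adj_irrefl : irreflexive adj }.

Definition edge_set (G : sgraph) : {set {set G}} :=
  [set [set x; y] | x in G, y in adj x].

Definition proper_coloring (G : sgraph) (k : nat) (f : {ffun G -> 'I_k}) : bool :=
  [forall x : G, forall y : G, adj x y ==> (f x != f y)].

Definition colorable (G : sgraph) (k : nat) : bool :=
  [exists f : {ffun G -> 'I_k}, proper_coloring f].

Lemma colorable_exists (G : sgraph) : exists k, colorable G k.
Proof.
exists #|G|; apply/existsP; exists [ffun x => enum_rank x].
apply/forallP => x; apply/forallP => y; apply/implyP => xy; rewrite !ffunE.
by apply/eqP => /enum_rank_inj eq_xy; rewrite eq_xy adj_irrefl in xy.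
Qed.

Definition chromatic_number (G : sgraph) : nat := ex_minn (colorable_exists G).

Definition chromatic (k : nat) (G : sgraph) : Prop := chromatic_number G = k.

Definition connected_graph (G : sgraph) : Prop :=
  0 < #|G| /\ forall x y : G, connect (@adj G) x y.

Section DeleteVertices.
Variables (G : sgraph) (S : {set G}).

Definition del_adj : rel {x : G | x \notin S} := fun x y => adj (val x) (val y).

Lemma del_adj_sym : symmetric del_adj.
Proof. by move=> x y; apply: adj_sym. Qed.

Lemma del_adj_irrefl : irreflexive del_adj.
Proof. by move=> x; apply: adj_irrefl. Qed.

Definition del_vertices : sgraph := SGraph del_adj_sym del_adj_irrefl.

End DeleteVertices.

Definition vertex_connected (l : nat) (G : sgraph) : Prop :=
  l < #|G| /\ forall S : {set G}, #|S| < l -> connected_graph (del_vertices S).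

(* Main.v *)
Require Import Defs.
From mathcomp Require Import all_boot all_order all_algebra.
From mathcomp Require Import zify.

Set Implicit Arguments.
Unset Strict Implicit.
Unset Printing Implicit Defensive.

(** Lower bound.  A graph [G] that is not (k-1)-colourable has a nonempty set
    [U] of vertices each of which has at least k-1 neighbours inside [U] (take
    [U] minimal among the sets whose induced subgraph is not (k-1)-colourable:
    [dense_core]); in particular [U] has at least k elements.  Every vertex has
    degree at least l.  Sum the degrees, splitting those at [U] into the part
    inside [U] and the part leaving it.  If [U] is not everything, at least l
    edges leave [U], for otherwise their ends in [U], fewer than l < k <= |U|
    vertices, would separate the rest of [U] from its complement; hence
      2|E| >= |U|(k-1) + l + (n-|U|)l >= k(k-1) + (n-k+1)l.
    If [U] is everything, then 2|E| >= n(k-1), which suffices because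
    n-k >= l and k-1-l >= 1.  This is [leq_double_edges].

    Sharpness.  On n-k+1 vertices the Harary graph is l-connected with
    ceil((n-k+1)l/2) edges ([harary_connected], [leq_harary_edges]).  Replace
    one of its vertices z by a complete graph on k vertices, the edges at z
    being sent to distinct vertices of the clique.  This adds k(k-1)/2 edges
    ([expansion_edges]) and preserves l-connectivity because k > l
    ([expansion_connected]).  The new graph contains a clique on k vertices,
    and its remaining vertices have degree at most l+1 < k, so no set can be a
    dense core for k colours: the graph is k-chromatic
    ([expansion_chromatic]).  Only an upper bound on the number of edges of the
    Harary graph is needed, the lower bound already proved giving equality.

    Connectivity is handled throughout via separations, that is, pairs of
    nonempty disjoint vertex sets with no edge between them: a graph with more
    than l vertices is l-connected iff the complement of every separation has
    at least l vertices ([vertex_connectedP]). *)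

(** * Degrees and separations *)

Definition neighbours (G : sgraph) (x : G) : {set G} := [set y | adj x y].

(** Both sides count the ordered pairs of adjacent vertices. *)
Lemma handshake (G : sgraph) : \sum_(x : G) #|neighbours x| = #|edge_set G|.*2.
Proof.
transitivity (\sum_(p : G * G | adj p.1 p.2) 1).
  rewrite -(pair_big_dep xpredT (fun x y : G => adj x y) (fun _ _ => 1)) /=.
  by apply: eq_bigr => x _; rewrite sum1dep_card cardsE.
rewrite (partition_big (fun p : G * G => [set p.1; p.2]) (mem (edge_set G))) /=; last first.
  by move=> [x y] /= xy; apply/imset2P; exists x y.
rewrite -muln2 -sum_nat_const; apply: eq_bigr => _ /imset2P[x y _ xy ->].
change (is_true (adj x y)) in xy.
have nxy : x != y by apply: contraTneq xy => ->; rewrite adj_irrefl.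
rewrite sum1dep_card; transitivity #|[set (x, y); (y, x)]|; last first.
  by rewrite cards2 xpair_eqE negb_and nxy.
apply: eq_card => -[a b]; rewrite !inE !xpair_eqE /=.
apply/andP/orP => [[ab /eqP E]|].
  have := set21 a b; have := set22 a b; rewrite E !inE.
  have nab : a != b by apply: contraTneq ab => ->; rewrite adj_irrefl.
  by case/orP=> /eqP eb /orP[]/eqP ea; move: nab; rewrite ea eb ?eqxx; [|right|left|].
by case=> /andP[/eqP-> /eqP->]; split=> //; rewrite 1?adj_sym // setUC.
Qed.

Definition separated (G : sgraph) (A B : {set G}) :=
  [/\ A != set0, B != set0, [disjoint A & B]
    & forall x y, x \in A -> y \in B -> ~~ adj x y].

Lemma separated_sym (G : sgraph) (A B : {set G}) :
  separated A B -> separated B A.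
Proof.
case=> A0 B0 dAB nAB; split=> //; first by rewrite disjoint_sym.
by move=> x y xB yA; rewrite adj_sym nAB.
Qed.

(** One direction follows a path from [A] to [B], which cannot leave [A]; for the
    other, the component of a vertex that does not reach some [y] outside [S],
    together with the rest of the complement of [S], is a separation. *)
Lemma vertex_connectedP (l : nat) (G : sgraph) :
  vertex_connected l G <->
  l < #|G| /\ forall A B : {set G}, separated A B -> l <= #|~: (A :|: B)|.
Proof.
split=> -[lG H]; split=> //.
  move=> A B [/set0Pn[a aA] /set0Pn[b bB] dAB nAB].
  rewrite leqNgt; apply/negP => /H[_ conn].
  have notS x : (x \in A) || (x \in B) -> x \notin ~: (A :|: B).
    by rewrite !inE negbK.
  have aS : a \notin ~: (A :|: B) by rewrite notS ?aA.
  have bS : b \notin ~: (A :|: B) by rewrite notS ?bB ?orbT.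
  have /connectP[p] := conn (Sub a aS) (Sub b bS).
  have : val (Sub a aS : {x | x \notin ~: (A :|: B)}) \in A by [].
  have : val (Sub b bS : {x | x \notin ~: (A :|: B)}) \in B by [].
  move: (Sub a aS) (Sub b bS) => {aA bB aS bS} {}a {}b bB aA pth eb.
  elim: p a aA pth eb => [|c p IH] a aA /=.
    by move=> _ eb; rewrite eb in bB; rewrite (disjointFr dAB aA) in bB.
  case/andP=> ac pth eb; apply: (IH c _ pth eb).
  have := valP c; rewrite !inE negbK => /orP[//|cB].
  by have := nAB _ _ aA cB; rewrite -[adj _ _]/(del_adj a c) ac.
move=> S Sl.
have CS : 0 < #|~: S| by rewrite cardsCs setCK; lia.
split.
  by rewrite card_sig; move: CS; rewrite cardsE.
move=> x y; apply/idPn => nxy.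
pose A := [set val u | u : {x | x \notin S} & connect (@adj (del_vertices S)) x u].
have xA : val x \in A by apply/imsetP; exists x; rewrite ?inE ?connect0.
have AS : forall u, u \in A -> u \notin S.
  by move=> _ /imsetP[u _ ->]; apply: (valP u).
pose B := ~: (A :|: S).
have yB : val y \in B.
  rewrite !inE negb_or (valP y) andbT; apply/imsetP => -[u]; rewrite inE => xu /val_inj yu.
  by rewrite yu xu in nxy.
have : l <= #|~: (A :|: B)|.
  apply: H; split.
  - by apply/set0Pn; exists (val x).
  - by apply/set0Pn; exists (val y).
  - rewrite disjoint_sym -setI_eq0 setIC -subset0; apply/subsetP => u.
    by rewrite !inE; case: (u \in A).
  move=> w v /imsetP[u]; rewrite inE => xu -> {w}; rewrite !inE negb_or => /andP[vA vS].
  apply: contra vA => uv; apply/imsetP; exists (Sub v vS) => //; rewrite inE.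
  by apply: connect_trans xu (connect1 _).
suff : #|~: (A :|: B)| <= #|S| by lia.
apply: subset_leq_card; apply/subsetP => u; rewrite !inE.
by case: (u \in A) => //=; rewrite negbK.
Qed.

(** The neighbours of [x] separate it from the remaining vertices, unless nothing
    remains, in which case the degree is |G| - 1 >= l. *)
Lemma leq_neighbours (l : nat) (G : sgraph) (x : G) :
  vertex_connected l G -> l <= #|neighbours x|.
Proof.
move=> /vertex_connectedP[lG sepG].
have notNx : x \notin neighbours x by rewrite inE adj_irrefl.
pose B := ~: (x |: neighbours x).
have [B0|B0] := eqVneq B set0.
  have := cardsC (x |: neighbours x); rewrite -/B B0 cards0 cardsU1 notNx.
  by rewrite addn0 add1n => e; rewrite -ltnS e.
have -> : neighbours x = ~: ([set x] :|: B).
  apply/setP => y; rewrite !inE; case: eqVneq => [->|_] /=; first by rewrite adj_irrefl.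
  by rewrite negbK.
apply: sepG; split=> //.
- by apply/set0Pn; exists x; rewrite set11.
- by rewrite disjoints1 !inE eqxx.
by move=> _ y /set1P-> ; rewrite !inE negb_or => /andP[].
Qed.

(** * Vertex sets of large minimum degree in graphs of large chromatic number *)

(** In a minimal set [U] that is not q-colourable, a vertex with fewer than [q]
    neighbours in [U] could be removed, the rest coloured, and the vertex given
    a colour missing among its neighbours. *)
Lemma dense_core (G : sgraph) (q : nat) :
  0 < q -> ~~ colorable G q ->
  exists2 U : {set G}, U != set0
    & forall x, x \in U -> q <= #|neighbours x :&: U|.
Proof.
move=> q0 ncol.
pose col_on (U : {set G}) := [exists f : {ffun G -> 'I_q},
   [forall x in U, forall y in U, adj x y ==> (f x != f y)]].
have [U /minsetP[ncU minU]] : {U | minset (fun U => ~~ col_on U) U}.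
  suff nT : ~~ col_on setT.
    by have [U] := @minset_exists _ (fun U => ~~ col_on U) _ nT; exists U.
  apply: contra ncol => /existsP[f /forallP fP]; apply/existsP; exists f.
  apply/forallP => x; apply/forallP => y.
  by have := fP x; rewrite inE => /forallP/(_ y); rewrite inE.
exists U.
  apply: contraNneq ncU => ->; apply/existsP; exists [ffun=> Ordinal q0].
  by apply/forallP => x; rewrite inE.
move=> x xU; rewrite leqNgt; apply: contra ncU => degx.
have /existsP[f /forall_inP fP] : col_on (U :\ x).
  apply: contraT => nc; have /setP/(_ x) := minU _ nc (subD1set _ _).
  by rewrite setD11 xU.
have [c cP] : exists c : 'I_q, c \notin f @: (neighbours x :&: U).
  apply/existsP; rewrite -negb_forall; apply/negP => /forallP all_c.
  have : #|'I_q| <= #|f @: (neighbours x :&: U)|.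
    by apply: subset_leq_card; apply/subsetP => c _; apply: all_c.
  by rewrite card_ord => /leq_trans/(_ (leq_imset_card _ _)); lia.
have cN y : y \in U -> adj x y -> c != f y.
  by move=> yU xy; apply: contraNneq cP => ->; apply: imset_f; rewrite !inE xy.
apply/existsP; exists [ffun y => if y == x then c else f y].
apply/forall_inP => y yU; apply/forall_inP => w wU; apply/implyP => yw; rewrite !ffunE.
case: (eqVneq y x) => [yx|yx]; case: (eqVneq w x) => [wx|wx].
- by rewrite yx wx adj_irrefl in yw.
- by rewrite cN // -yx.
- by rewrite eq_sym cN // -wx adj_sym.
have yU' : y \in U :\ x by rewrite !inE yx.
have /forall_inP fPy := fP y yU'.
by have := fPy w; rewrite !inE wx wU yw => /(_ isT).
Qed.

(** * The lower bound *)

(** If fewer than [l] vertices of [U] had neighbours outside, deleting them would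
    separate the rest of [U] from the complement of [U]. *)
Lemma leq_crossing_edges (l : nat) (G : sgraph) (U : {set G}) :
  vertex_connected l G -> l <= #|U| -> U != setT ->
  l <= \sum_(x in U) #|neighbours x :\: U|.
Proof.
move=> /vertex_connectedP[lG sepG] lU UT.
pose T := [set x in U | neighbours x :\: U != set0].
have TU : T \subset U by apply/subsetP => x; rewrite inE => /andP[].
apply: (@leq_trans #|T|); last first.
  rewrite -sum1_card [leqRHS](big_setID T) /= (setIidPr TU).
  apply: leq_trans (leq_addr _ _); apply: leq_sum => x.
  by rewrite inE card_gt0 => /andP[].
have [/eqP|UT0] := eqVneq (U :\: T) set0.
  by rewrite setD_eq0 => /subset_leq_card; apply: leq_trans.
have -> : T = ~: ((U :\: T) :|: ~: U).
  apply/setP => x; rewrite in_setC in_setU in_setD in_setC negb_or negb_and !negbK.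
  by case xT: (x \in T) => /=; rewrite ?andNb //; apply/esym/(subsetP TU).
apply: sepG; split=> //.
- by apply: contra UT => /eqP/(congr1 (@setC _)); rewrite setCK setC0 => ->.
- by rewrite -setI_eq0 setIDAC setICr set0D.
move=> x y; rewrite in_setD inE => /andP[]; case xU: (x \in U) => //=.
rewrite negbK => /eqP/setP/(_ y) Nx _; rewrite inE => yU.
by move: Nx; rewrite !inE yU /= => ->.
Qed.

(** Twice the lower bound of the theorem, so as to stay in the integers. *)
Lemma leq_double_edges (n k l : nat) (G : sgraph) :
  l < k - 1 -> l <= n - k -> #|G| = n -> chromatic k G -> vertex_connected l G ->
  k * (k - 1) + (n - k + 1) * l <= #|edge_set G|.*2.
Proof.
move=> lk ln cG chrG conG.
have ncol : ~~ colorable G (k - 1).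
  apply/negP => col; move: chrG; rewrite /chromatic /chromatic_number.
  by case: ex_minnP => m _ /(_ _ col) mk mE; lia.
have [|U /set0Pn[u uU] denseU] := dense_core _ ncol; first lia.
have kU : k <= #|U|.
  have uN : u \notin neighbours u :&: U by rewrite !inE adj_irrefl.
  have : u |: (neighbours u :&: U) \subset U.
    by apply/subsetP => x; rewrite !inE => /predU1P[->|/andP[]].
  by move/subset_leq_card; rewrite cardsU1 uN; have := denseU u uU; lia.
have inU : #|U| * (k - 1) <= \sum_(x in U) #|neighbours x :&: U|.
  by rewrite -sum_nat_const; apply: leq_sum.
rewrite -handshake (bigID (mem U)) /=.
rewrite (eq_bigr (fun x => #|neighbours x :&: U| + #|neighbours x :\: U|)); last first.
  by move=> x _; rewrite cardsID.
rewrite big_split /=.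
have outU : #|~: U| * l <= \sum_(x | x \notin U) #|neighbours x|.
  rewrite -sum_nat_const; under [leqLHS]eq_bigl do rewrite inE.
  by apply: leq_sum => x _; apply: leq_neighbours.
have cU : #|U| + #|~: U| = n by rewrite cardsC.
have [UT|UT] := eqVneq U setT.
  move: cU; rewrite UT setCT cards0 addn0 -UT => cU.
  apply: leq_trans (leq_trans inU _); last by rewrite -addnA leq_addr.
  (* n(k-1) - k(k-1) - (n-k+1)l = (n-k)(k-1-l) - l *)
  have : l * 1 <= (n - k) * (k - 1 - l) by apply: leq_mul; lia.
  rewrite cU; nia.
have cut := leq_crossing_edges conG _ UT.
have : (#|U| - k) * l <= (#|U| - k) * (k - 1) by apply: leq_mul; lia.
have := cut _; nia.
Qed.

(** * Separations of cyclic sequences *)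

(** Take [e] and [f] the first and the last element of [pB] in the window, [m] the
    last element of [pA] before [e], and [q] the first one after [f]. *)
Lemma first_last_gaps (pA pB : pred nat) (a b c : nat) :
  a < b < c -> pA a -> pB b -> pA c ->
  exists m e f q, [/\ [&& a <= m, m < e, e <= f, f < q & q <= c],
    [/\ pA m, pB e, pB f & pA q]
    & forall i, (m < i < e) || (f < i < q) -> ~~ pA i /\ ~~ pB i].
Proof.
case/andP=> ab bc paA pbB pcA.
have exe : exists i, (a < i) && pB i by exists b; rewrite ab.
have [e /andP[ae peB] mine] := ex_minnP exe.
have exf : exists i, (i < c) && pB i by exists b; rewrite bc.
have bnd p d i : (i < d) && p i -> i <= d by case/andP=> /ltnW.
have [f /andP[fc pfB] maxf] := ex_maxnP exf (bnd pB c).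
have exm : exists i, (i < e) && pA i by exists a; rewrite ae.
have [m /andP[me pmA] maxm] := ex_maxnP exm (bnd pA e).
have exq : exists i, (f < i) && pA i by exists c; rewrite fc.
have [q /andP[fq pqA] minq] := ex_minnP exq.
have am : a <= m by apply: maxm; rewrite ae.
have qc : q <= c by apply: minq; rewrite fc.
have ef : e <= f.
  by apply: (@leq_trans b); [apply: mine; rewrite ab | apply: maxf; rewrite bc].
exists m, e, f, q; split=> //; first by rewrite am me ef fq qc.
move=> i /orP[] /andP[lo hi]; split; apply/negP => pi.
- by have := maxm i; rewrite hi pi leqNgt lo => /(_ isT).
- by have := mine i; rewrite (leq_ltn_trans am lo) pi leqNgt hi => /(_ isT).
- by have := minq i; rewrite lo pi leqNgt hi => /(_ isT).
by have := maxf i; rewrite (leq_trans hi qc) pi leqNgt lo => /(_ isT).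
Qed.

(** The labels [pA] and [pB] are read around a cycle of length [N], so that passing
    from one label to the other takes more than [r] steps.  Going around from
    [a], the passage from [pA] to the first [pB] and the one from the last [pB]
    back to [pA] each contain [r] unlabelled positions.  If there are no further
    unlabelled positions, the labels cannot change elsewhere, and the two labels
    occupy the two arcs left by these gaps.  The bound [c] on the number of
    unlabelled positions per period is stated through duplicate-free lists, so
    that exhibiting positions in one window is all that is needed to count. *)
Lemma two_gaps (N r c a b : nat) (pA pB : pred nat) :
    0 < r -> a < b < a + N -> pA a -> pB b ->
    (forall i, pA (i + N) = pA i) -> (forall i, pB (i + N) = pB i) ->
    (forall i d, 0 < d <= r -> pA i -> pB (i + d) -> False) ->
    (forall i d, 0 < d <= r -> pB i -> pA (i + d) -> False) ->
    (forall s, uniq s ->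
      (forall i, i \in s -> [/\ a <= i, i < a + N, ~~ pA i & ~~ pB i]) ->
      size s <= c) ->
  r.*2 <= c /\
  (c <= r.*2 -> exists m e f, [/\ e = m + r + 1, e <= f, f + r < m + N,
     forall i, e <= i <= f -> pB i
   & forall i, f + r < i <= m + N -> pA i]).
Proof.
move=> r0 ab paA pbB pAN pBN nearAB nearBA count.
have [m [e [f [q [/and5P[am me ef fq qN] [pmA peB pfB pqA] gap]]]]] :=
  first_last_gaps ab paA pbB (etrans (pAN a) paA).
have gap1 i : m < i -> i < e -> ~~ pA i /\ ~~ pB i.
  by move=> mi ie; apply: gap; rewrite mi ie.
have gap2 i : f < i -> i < q -> ~~ pA i /\ ~~ pB i.
  by move=> fi iq; apply: gap; rewrite fi iq orbT.
clear gap b ab pbB paA.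
have mre : m + r < e.
  rewrite ltnNge; apply/negP => er; apply: (@nearAB m (e - m)) => //; first lia.
  by rewrite subnKC // ltnW.
have frq : f + r < q.
  rewrite ltnNge; apply/negP => er; apply: (@nearBA f (q - f)) => //; first lia.
  by rewrite subnKC // ltnW.
pose s := iota m.+1 r ++ iota f.+1 r.
have us : uniq s.
  rewrite cat_uniq !iota_uniq andbT /=; apply/hasPn => i; rewrite !mem_iota; lia.
have sS i : i \in s -> [/\ a <= i, i < a + N, ~~ pA i & ~~ pB i].
  rewrite mem_cat !mem_iota => /orP[]/andP[lo hi].
    have [ie ai iN] : [/\ i < e, a <= i & i < a + N] by split; lia.
    by have [] := gap1 i lo ie.
  have [iq ai iN] : [/\ i < q, a <= i & i < a + N] by split; lia.
  by have [] := gap2 i lo iq.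
have := count s us sS; rewrite size_cat !size_iota addnn => rc; split=> // cr.
have inS i : a <= i -> i < a + N -> ~~ pA i -> ~~ pB i ->
    (m < i <= m + r) || (f < i <= f + r).
  move=> ai iN iA iB; have : i \in s; last first.
    by rewrite mem_cat !mem_iota !addSn !ltnS.
  apply: contraT => si; have : size (i :: s) <= c; last first.
    by rewrite /= size_cat !size_iota addnn ltnNge cr.
  by apply: (count (i :: s)) => [|j]; [rewrite /= si | rewrite inE => /predU1P[->|/sS]].
have eE : e = m + r + 1.
  have [|lt|//] := ltngtP e (m + r + 1); first lia.
  have [nA nB] : ~~ pA (m + r + 1) /\ ~~ pB (m + r + 1) by apply: gap1; lia.
  by have := inS (m + r + 1) _ _ nA nB; lia.
have qE : q = f + r + 1.
  have [|lt|//] := ltngtP q (f + r + 1); first lia.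
  have [nA nB] : ~~ pA (f + r + 1) /\ ~~ pB (f + r + 1) by apply: gap2; lia.
  by have := inS (f + r + 1) _ _ nA nB; lia.
have arcB i : e <= i <= f -> pB i.
  elim: i => [|i IH] ief; first lia.
  have [<-//|ie] := eqVneq e i.+1.
  have piB : pB i by apply: IH; lia.
  have nA : ~~ pA i.+1 by apply/negP; rewrite -addn1; apply: nearBA => //; rewrite r0.
  apply: contraT => nB; have := inS i.+1 _ _ nA nB; lia.
have arcA i : q <= i <= m + N -> pA i.
  elim: i => [|i IH] iqm; first lia.
  have [<-//|iq] := eqVneq q i.+1.
  have piA : pA i by apply: IH; lia.
  have nB : ~~ pB i.+1 by apply/negP; rewrite -addn1; apply: nearAB => //; rewrite r0.
  apply: contraT => nA.
  have [iN|iN] := ltnP i.+1 (a + N); first by have := inS i.+1 _ _ nA nB; lia.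
  (* past the end of the window, i.+1 - N lies between a and m *)
  have E : i.+1 = (i.+1 - N) + N by lia.
  move: nA nB; rewrite E pAN pBN => nA nB.
  by have := inS (i.+1 - N) _ _ nA nB; lia.
exists m, e, f; split=> //; first lia.
by move=> i iqm; apply: arcA; lia.
Qed.

(** * Harary graphs *)

Section Generated.
Variables (T : finType) (e : rel T).
Definition gen_adj : rel T := fun x y => (x != y) && (e x y || e y x).

Lemma gen_adj_sym : symmetric gen_adj.
Proof. by move=> x y; rewrite /gen_adj eq_sym orbC. Qed.

Lemma gen_adj_irrefl : irreflexive gen_adj.
Proof. by move=> x; rewrite /gen_adj eqxx. Qed.

Definition generated_graph := SGraph gen_adj_sym gen_adj_irrefl.

Lemma leq_gen_degree (x : generated_graph) :
  #|neighbours x| <= #|[set y | e x y]| + #|[set y | e y x]|.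
Proof.
rewrite (leq_trans _ (leq_card_setU _ _)) //; apply: subset_leq_card.
by apply/subsetP => y; rewrite !inE => /andP[].
Qed.

Lemma leq_gen_edges : #|edge_set generated_graph| <= \sum_x #|[set y | e x y]|.
Proof.
rewrite -leq_double -handshake (leq_trans (leq_sum _ (fun x _ => leq_gen_degree x))) //.
rewrite big_split -addnn leq_add2l /=.
have cardE (P : pred T) : #|[set y | P y]| = \sum_y P y.
  by rewrite -sum1dep_card big_mkcond; apply: eq_bigr => y _; case: (P y).
under eq_bigr do rewrite cardE; rewrite exchange_big /=.
by under [leqRHS]eq_bigr do rewrite cardE.
Qed.
End Generated.

Lemma leq_card_exists (T : finType) (n : nat) (P : 'I_n -> pred T) :
  (forall t, #|[set y | P t y]| <= 1) -> #|[set y | [exists t, P t y]]| <= n.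
Proof.
move=> P1; have -> : [set y | [exists t, P t y]] = \bigcup_t [set y | P t y].
  apply/setP => y; rewrite inE; apply/existsP/bigcupP => [[t Py]|[t _]].
    by exists t; rewrite ?inE.
  by rewrite inE => Py; exists t.
apply: (@leq_trans (\sum_(t < n) 1)); last by rewrite sum1_card card_ord.
apply: (big_ind2 (fun (A : {set T}) k => #|A| <= k)) => //; first by rewrite cards0.
by move=> A a B b Aa Bb; rewrite (leq_trans (leq_card_setU _ _)) ?leq_add.
Qed.

(** Each [i] sends arcs to its [l./2] successors on the cycle and, for odd [l], to the
    antipodal [i + N./2] when this does not wrap around.  Not wrapping keeps the
    number of antipodal arcs down to [uphalf N], while every vertex still
    meets one of them; for odd [N] the vertex [N./2] meets two. *)
Section Harary.
Variables (w l : nat).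
Local Notation N := w.+1.
Local Notation r := (l./2).

Definition harary_arc (i j : 'I_N) :=
  [exists t : 'I_r, j == (i + t.+1) %% N :> nat]
  || odd l && (j == i + N./2 :> nat).

Definition harary := generated_graph harary_arc.

Lemma card_le1_ord (P : pred 'I_N) :
  (forall i j : 'I_N, P i -> P j -> i = j :> nat) -> #|[set i | P i]| <= 1.
Proof.
move=> P1; apply/card_le1_eqP => i j; rewrite !inE => Pi Pj.
exact/val_inj/P1.
Qed.

Lemma leq_harary_out (i : 'I_N) :
  #|[set j | harary_arc i j]| <= r + (odd l && (i < uphalf N)).
Proof.
have -> : [set j | harary_arc i j] =
    [set j : 'I_N | [exists t : 'I_r, j == (i + t.+1) %% N :> nat]]
    :|: [set j : 'I_N | odd l && (j == i + N./2 :> nat)].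
  by apply/setP => j; rewrite !inE.
apply: leq_trans (leq_card_setU _ _) _; apply: leq_add.
  by apply: leq_card_exists => t; apply: card_le1_ord => j1 j2 /eqP-> /eqP ->.
case: (odd l) => /=; last by rewrite leqn0 cards_eq0; apply/eqP/setP => j; rewrite !inE.
case: ltnP => iN; first by apply: card_le1_ord => j1 j2 /eqP-> /eqP->.
rewrite leqn0 cards_eq0; apply/eqP/setP => j; rewrite !inE.
by apply/eqP => jE; have := ltn_ord j; lia.
Qed.

Lemma leq_harary_in (i : 'I_N) :
  #|[set j | harary_arc j i]| <= r + odd l.
Proof.
have -> : [set j | harary_arc j i] =
    [set j : 'I_N | [exists t : 'I_r, i == (j + t.+1) %% N :> nat]]
    :|: [set j : 'I_N | odd l && (i == j + N./2 :> nat)].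
  by apply/setP => j; rewrite !inE.
apply: leq_trans (leq_card_setU _ _) _; apply: leq_add.
  apply: leq_card_exists => t; apply: card_le1_ord => j1 j2 /eqP-> .
  by rewrite eqn_modDr !modn_small // => /eqP.
case: (odd l) => /=; last by rewrite leqn0 cards_eq0; apply/eqP/setP => j; rewrite !inE.
by apply: card_le1_ord => j1 j2 /eqP-> /eqP/addIn.
Qed.

Lemma leq_harary_edges : #|edge_set harary| <= uphalf (N * l).
Proof.
apply: leq_trans (leq_gen_edges _) _.
apply: leq_trans (leq_sum _ (fun i _ => leq_harary_out i)) _.
have cnt : \sum_(i < N) (i < uphalf N) = uphalf N.
  transitivity (\sum_(i < N | i < uphalf N) 1).
    by rewrite [RHS]big_mkcond; apply: eq_bigr => i _; case: ifP.
  rewrite -(big_ord_widen N (fun _ => 1)) ?sum1_card ?card_ord //; lia.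
rewrite big_split /= sum_nat_const card_ord.
have -> : \sum_(i < N) (odd l && (i < uphalf N) : nat) = odd l * uphalf N.
  by rewrite -[in RHS]cnt big_distrr; apply: eq_bigr => i _; rewrite -mulnb.
rewrite -[in leqRHS](odd_double_half l).
case: (odd l) => /=; lia.
Qed.

Lemma leq_harary_degree (i : harary) : #|neighbours i| <= l.+1.
Proof.
rewrite (leq_trans (@leq_gen_degree 'I_N harary_arc i)) //.
apply: leq_trans (leq_add (leq_harary_out i) (leq_harary_in i)) _.
case: (odd l) (odd_double_half l) => /=; [case: (_ < _)|]; lia.
Qed.

Hypotheses (l_gt1 : 1 < l) (l_ltN : l < N).

Definition point (i : nat) : harary := Ordinal (ltn_pmod i (ltn0Sn w)).

Lemma pointD (i : nat) : point (i + N) = point i.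
Proof. by apply/val_inj; rewrite /= modnDr. Qed.

Lemma point_val (i : harary) : point (val i) = i.
Proof. by apply/val_inj; rewrite /= modn_small. Qed.

Lemma point_inj (a i j : nat) :
  a <= i < a + N -> a <= j < a + N -> point i = point j -> i = j.
Proof.
move=> ia ja /(congr1 val) /= /eqP.
wlog ij : i j ia ja / i <= j => [H|].
  case: (leqP i j) => [ij|/ltnW ji]; first exact: H.
  by rewrite eq_sym => ji_mod; symmetry; apply: H.
rewrite eq_sym eqn_mod_dvd // => /dvdnP[c jE].
suff : c = 0 by lia.
nia.
Qed.

Lemma harary_near (i d : nat) : 0 < d <= r -> adj (point i) (point (i + d)).
Proof.
move=> dr; have lE := odd_double_half l; apply/andP; split.
  by apply/eqP => E; have := @point_inj i i (i + d) _ _ E; lia.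
apply/orP; left; apply/orP; left; apply/existsP.
have dlt : d.-1 < r by lia.
by exists (Ordinal dlt); rewrite /= prednK ?modnDml //; lia.
Qed.

(** A vertex [i] in the last [N./2] places is the head of an antipodal arc, and
    going back [N./2] steps is going forward [uphalf N] steps. *)
Lemma harary_antipode (i : nat) : odd l ->
  exists2 h, N./2 <= h <= uphalf N & adj (point i) (point (i + h)).
Proof.
move=> ol; have iE := divn_eq i N.
have nE h : N./2 <= h <= uphalf N -> point i != point (i + h).
  by move=> hN; apply/eqP => E; have := @point_inj i i (i + h) _ _ E; lia.
have ltN := ltn_pmod i (ltn0Sn w).
case: (ltnP (i %% N) (uphalf N)) => iN.
  exists N./2; first lia.
  apply/andP; split; first by apply: nE; lia.
  by apply/orP; left; apply/orP; right; rewrite ol /= -modnDml modn_small //; lia.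
exists (uphalf N); first lia.
apply/andP; split; first by apply: nE; lia.
apply/orP; right; apply/orP; right; rewrite ol /= -modnDml.
have -> : i %% N + uphalf N = (i %% N - N./2) + N by lia.
by rewrite modnDr [(i %% N - _) %% N]modn_small; lia.
Qed.

(** By [two_gaps] the complement of a separation has at least [2 * l./2] vertices.
    If [l] is odd and there are no more, the two sides are arcs whose lengths
    add up to [N - 2 * l./2].  An antipode of an end of the shorter arc lies in
    the other arc, so that the two sides are adjacent after all. *)
Lemma harary_connected : vertex_connected l harary.
Proof.
apply/vertex_connectedP; split; first by rewrite card_ord.
move=> A B [/set0Pn[a0 aA] /set0Pn[b0 bB] dAB nAB]; set S := ~: _.
pose pA i := point i \in A; pose pB i := point i \in B.
have notAB i : pA i -> pB i -> False by move=> iA; rewrite /pB (disjointFr dAB iA).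
have pAN i : pA (i + N) = pA i by rewrite /pA pointD.
have pBN i : pB (i + N) = pB i by rewrite /pB pointD.
have nearAB i d : 0 < d <= r -> pA i -> pB (i + d) -> False.
  by move=> dr iA iB; have := nAB _ _ iA iB; rewrite harary_near.
have nearBA i d : 0 < d <= r -> pB i -> pA (i + d) -> False.
  by move=> dr iA iB; have := nAB _ _ iB iA; rewrite adj_sym harary_near.
have count a (s : seq nat) : uniq s ->
    (forall i, i \in s -> [/\ a <= i, i < a + N, ~~ pA i & ~~ pB i]) -> size s <= #|S|.
  move=> us sS; rewrite -(size_map point) cardE; apply: uniq_leq_size.
    rewrite map_inj_in_uniq // => i j /sS[? ? _ _] /sS[? ? _ _].
    by apply: (@point_inj a); apply/andP.
  move=> _ /mapP[i /sS[_ _ iA iB] ->].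
  by rewrite mem_enum !inE negb_or; apply/andP.
pose a : nat := val a0; have paA : pA a by rewrite /pA point_val.
have [b ab pbB] : exists2 b, a < b < a + N & pB b.
  pose b : nat := val b0; have pbB : pB b by rewrite /pB point_val.
  have ltb : b < N := ltn_ord b0; have lta : a < N := ltn_ord a0.
  have [ltab|ltba|eab] := ltngtP a b.
  - by exists b => //; lia.
  - by exists (b + N); rewrite // ?pBN //; lia.
  - by case: (notAB a) => //; rewrite eab.
have [||S2r exact2r] := @two_gaps N r #|S| a b pA pB _ ab paA pbB pAN pBN nearAB nearBA.
- lia.
- exact: (count a).
rewrite leqNgt; apply/negP => Sl.
have [ol lE] : odd l /\ l = r.*2.+1 by lia.
have [|m [e [f [eE ef fm arcB arcA]]]] := exact2r; first lia.
have [short|long] := leqP (f - e + 1 + r) N./2.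
  have [h hN eh] := harary_antipode e ol.
  have ehA : pA (e + h) by apply: arcA; lia.
  have eB : pB e by apply: arcB; lia.
  by have := nAB _ _ ehA eB; rewrite adj_sym eh.
have [h hN mh] := harary_antipode m ol.
have mhB : pB (m + h) by apply: arcB; lia.
have mA : pA m by rewrite -pAN; apply: arcA; lia.
by have := nAB _ _ mA mhB; rewrite mh.
Qed.
End Harary.

(** * Replacing a vertex by a clique *)

Lemma injective_labelling (T : finType) (A : {set T}) (k : nat) :
  0 < k -> #|A| <= k -> exists phi : T -> 'I_k, {in A &, injective phi}.
Proof.
case: k => // k _ Ak; exists (fun x => inord (index x (enum A))) => x y xA yA /(congr1 val) /=.
have idx u : u \in A -> index u (enum A) < k.+1.
  by move=> uA; rewrite (leq_trans _ Ak) // cardE index_mem mem_enum.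
rewrite !inordK ?idx // => e.
by rewrite -(nth_index x (s := enum A) (x := x)) ?mem_enum // e nth_index ?mem_enum.
Qed.

Lemma degreeE (G : sgraph) (x : G) : #|neighbours x| = \sum_y adj x y.
Proof.
by rewrite -sum1_card big_mkcond; apply: eq_bigr => y _; rewrite inE; case: adj.
Qed.

Lemma double_bin2 (n : nat) : 'C(n, 2).*2 = n * n.-1.
Proof. by rewrite bin2 halfK oddM; case: n => // n; rewrite /= andNb subn0. Qed.

(** The vertex [z] of [H] is replaced by a clique indexed by ['I_k]; the edge from [z]
    to [x] is attached to the clique vertex [phi x]. *)
Section Expansion.
Variables (H : sgraph) (z : H) (k : nat) (phi : H -> 'I_k).
Local Notation rest := {x in [set~ z]}.

Definition expansion_adj (u v : 'I_k + rest) : bool :=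
  match u, v with
  | inl i, inl j => i != j
  | inl i, inr x | inr x, inl i => adj z (val x) && (phi (val x) == i)
  | inr x, inr y => adj (val x) (val y)
  end.

Lemma expansion_sym : symmetric expansion_adj.
Proof. by move=> [i|x] [j|y] //=; rewrite 1?eq_sym // adj_sym. Qed.

Lemma expansion_irrefl : irreflexive expansion_adj.
Proof. by move=> [i|x] /=; rewrite ?eqxx ?adj_irrefl. Qed.

Definition expansion := SGraph expansion_sym expansion_irrefl.

Lemma card_expansion : #|expansion| = k + #|H|.-1.
Proof.
by rewrite card_sum card_ord card_sig -(cardsC1 z).
Qed.

Lemma expansion_degree_rest (x : rest) :
  #|neighbours (inr x : expansion)| = #|neighbours (val x)|.
Proof.
rewrite !degreeE big_sumType /= -(big_sub _ (fun y => nat_of_bool (adj (val x) y))).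
rewrite [RHS](bigD1 z) //= (bigD1 (phi (val x))) //= eqxx andbT big1 ?addn0.
  by rewrite adj_sym; congr (_ + _); apply: eq_bigl => y; rewrite !inE.
by move=> i /negbTE; rewrite eq_sym => ->; rewrite andbF.
Qed.

Lemma expansion_degree_clique (i : 'I_k) :
  #|neighbours (inl i : expansion)| = k.-1 + \sum_(x : H) (adj z x && (phi x == i)).
Proof.
rewrite degreeE big_sumType /= -(big_sub _ (fun y => nat_of_bool (adj z y && (phi y == i)))).
rewrite [in RHS](bigD1 z) //= adj_irrefl add0n; congr (_ + _); last first.
  by apply: eq_bigl => y; rewrite !inE.
rewrite -[k in RHS]card_ord -(cardC1 i) -sum1_card [RHS]big_mkcond /=.
by apply: eq_bigr => j _; rewrite inE eq_sym; case: (_ == _).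
Qed.

Lemma expansion_edges : #|edge_set expansion| = 'C(k, 2) + #|edge_set H|.
Proof.
apply: double_inj; rewrite doubleD -!handshake big_sumType /=.
under eq_bigr do rewrite expansion_degree_clique.
under [X in _ + X]eq_bigr do rewrite expansion_degree_rest.
rewrite -(big_sub _ (fun x => #|neighbours x|)) big_split /= sum_nat_const card_ord.
rewrite exchange_big /= -addnA; congr (_ + _).
  by rewrite double_bin2.
rewrite [RHS](bigD1 z) //= degreeE; congr (_ + _); last first.
  by apply: eq_bigl => x; rewrite !inE.
apply: eq_bigr => x _; rewrite (bigD1 (phi x)) //= eqxx andbT big1 ?addn0 // => i /negbTE.
by rewrite eq_sym => ->; rewrite andbF.
Qed.

(** A dense core for [k] colours would consist of clique vertices, each of which
    has only k-1 neighbours in the clique. *)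
Lemma expansion_chromatic :
  0 < k -> (forall x, x != z -> #|neighbours x| < k) -> chromatic k expansion.
Proof.
move=> k0 degH; rewrite /chromatic /chromatic_number.
case: ex_minnP => m /existsP[f /forallP fP] minm.
apply/eqP; rewrite eqn_leq; apply/andP; split; last first.
  have injf : injective (fun i => f (inl i)).
    move=> i j fij; apply/eqP; apply: contraT => nij.
    by have /forallP/(_ (inl j)) := fP (inl i); rewrite /= nij fij eqxx.
  by have := leq_card _ injf; rewrite !card_ord.
apply: minm; apply: contraT => /(dense_core k0)[U /set0Pn[u uU] denseU].
have inU x : inr x \notin U.
  apply/negP => /denseU; rewrite leqNgt => /negP[].
  apply: leq_ltn_trans (subset_leq_card (subsetIl _ _)) _.
  by rewrite expansion_degree_rest degH //; have := valP x; rewrite !inE.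
case: u uU => [i iU|x /(negP (inU x)) //].
have := denseU _ iU; rewrite leqNgt => /negP[].
have : neighbours (inl i : expansion) :&: U \subset inl @: [set~ i].
  apply/subsetP => -[j|x]; rewrite !inE /=; last by rewrite (negbTE (inU x)) andbF.
  by case/andP=> nij _; apply: imset_f; rewrite !inE eq_sym.
move/subset_leq_card/leq_ltn_trans; apply.
by rewrite (leq_ltn_trans (leq_imset_card _ _)) // cardsC1 card_ord prednK.
Qed.

Definition trace (X : {set expansion}) : {set H} := val @: (inr @^-1: X : {set rest}).

Lemma mem_trace (X : {set expansion}) (x : rest) :
  (val x \in trace X) = (inr x \in X).
Proof. by rewrite mem_imset ?inE //; apply: val_inj. Qed.

Lemma card_trace (X : {set expansion}) :
  #|X| = #|[set i | inl i \in X]| + #|trace X|.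
Proof.
rewrite card_imset; last exact: val_inj.
rewrite -sum1_card big_mkcond big_sumType /= -!big_mkcond /=.
by rewrite !sum1dep_card !cardsE; congr (_ + _); apply: eq_card => x; rewrite !inE.
Qed.

Lemma traceP (X : {set expansion}) (x : H) :
  reflect (exists2 u : rest, x = val u & inr u \in X) (x \in trace X).
Proof.
by apply: (iffP imsetP) => -[u]; rewrite ?inE => ux uX; exists u; rewrite ?inE.
Qed.

Lemma ex_rest (x : H) : x != z -> exists u : rest, x = val u.
Proof.
move=> xz; have xz' : x \in [set~ z] by rewrite !inE.
by exists (Sub x xz').
Qed.

Lemma z_notin_trace (X : {set expansion}) : z \notin trace X.
Proof. by apply/traceP => -[u zu _]; have := valP u; rewrite -zu !inE eqxx. Qed.

Lemma trace_separated (A B : {set expansion}) :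
  separated A B -> trace A != set0 -> trace B != set0 -> separated (trace A) (trace B).
Proof.
case=> _ _ dAB nAB tA tB; split=> //.
  rewrite -setI_eq0; apply/eqP/setP => x; rewrite in_setI in_set0.
  apply/andP => -[/traceP[u -> uA]]; rewrite mem_trace.
  by rewrite (disjointFr dAB uA).
move=> _ _ /traceP[u -> uA] /traceP[v -> vB].
exact: nAB uA vB.
Qed.

(** Let [A], [B] be a separation with complement [S], where [B] misses the clique,
    as one of the two sides must.  If the clique lies in [A], put [z] in the
    trace of [A]: this is a separation of [H] with no larger complement.
    Otherwise [S] meets the clique, so adding [z] to the trace of [S] does not
    exceed the size of [S], and the traces of [A] and [B] form a separation of
    [H] unless [A] lies in the clique.  In that last case each of the at least
    [l] edges at [z] has an end in [S], and these ends are distinct. *)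
Lemma expansion_connected (l : nat) :
  {in neighbours z &, injective phi} -> l < k -> vertex_connected l H ->
  vertex_connected l expansion.
Proof.
move=> injphi lk conH; have lNz := leq_neighbours z conH.
have /vertex_connectedP[_ sepH] := conH.
apply/vertex_connectedP; split.
  by rewrite card_expansion (leq_trans lk) ?leq_addr.
suff main (A B : {set expansion}) :
    separated A B -> (forall i, inl i \notin B) -> l <= #|~: (A :|: B)|.
  move=> A B sepAB; have [/existsP[j jB]|noB] := boolP [exists j, inl j \in B]; last first.
    by apply: main => // i; apply: contra noB => iB; apply/existsP; exists i.
  rewrite setUC; apply: main (separated_sym sepAB) _ => i; apply/negP => iA.
  have [_ _ dAB nAB] := sepAB; have := nAB _ _ iA jB; rewrite /= negbK => /eqP ij.
  by rewrite ij (disjointFl dAB jB) in iA.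
move=> sepAB KB; set S := ~: _.
have [A0 /set0Pn[b bB] dAB nAB] := sepAB.
have tB0 : trace B != set0.
  case: b bB => [i|u]; first by rewrite (negbTE (KB i)).
  by rewrite -mem_trace => uB; apply/set0Pn; exists (val u).
rewrite card_trace.
have inS v : v \notin A -> v \notin B -> v \in S by rewrite !inE negb_or => -> ->.
have [/forallP KA|] := boolP [forall i, inl i \in A].
  have sep : separated (z |: trace A) (trace B).
    split=> //.
    - by apply/set0Pn; exists z; rewrite !inE eqxx.
    - rewrite disjoints_subset subUset sub1set !inE z_notin_trace /=.
      rewrite -disjoints_subset -setI_eq0; apply/eqP/setP => x; rewrite in_setI in_set0.
      by apply/andP => -[/traceP[u -> uA]]; rewrite mem_trace (disjointFr dAB uA).
    move=> x _ /setU1P[->|/traceP[u -> uA]] /traceP[v -> vB]; last exact: nAB uA vB.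
    by have := nAB _ _ (KA (phi (val v))) vB; rewrite /= eqxx andbT.
  apply: leq_trans (sepH _ _ sep) (leq_trans _ (leq_addl _ _)).
  apply: subset_leq_card; apply/subsetP => x; rewrite !inE !negb_or => /andP[/andP[xz xA] xB].
  have [u xu] := ex_rest xz; move: xA xB; rewrite xu !mem_trace; exact: inS.
rewrite negb_forall => /existsP[i iA].
have iS : inl i \in S by apply: inS.
have [tA0|tA0] := eqVneq (trace A) set0.
  apply: leq_trans lNz _.
  have sub : neighbours z \subset [set x in neighbours z | inl (phi x) \in S] :|: trace S.
    apply/subsetP => x xN; have zx : adj z x by rewrite inE in xN.
    have [|u xu] := @ex_rest x; first by apply: contraTneq zx => ->; rewrite adj_irrefl.
    have uA : inr u \notin A by rewrite -mem_trace tA0 inE.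
    apply/setUP; have [uB|uB] := boolP (inr u \in B); last first.
      by right; rewrite xu mem_trace; apply: inS.
    left; apply/setIdP; split=> //; apply: inS => //; apply/negP => pA.
    by have := nAB _ _ pA uB; rewrite /= -xu zx eqxx.
  apply: leq_trans (subset_leq_card sub) (leq_trans (leq_card_setU _ _) _).
  rewrite leq_add2r -(card_in_imset (f := phi)); last first.
    by move=> x y /setIdP[xz _] /setIdP[yz _]; apply: injphi.
  apply: subset_leq_card; apply/subsetP => _ /imsetP[x /setIdP[_ xS] ->].
  by rewrite inE.
have sep := trace_separated sepAB tA0 tB0.
apply: leq_trans (sepH _ _ sep) _.
have sub : ~: (trace A :|: trace B) \subset z |: trace S.
  apply/subsetP => x; rewrite !inE negb_or; case: eqVneq => //= xz /andP[].
  have [u ->] := ex_rest xz; rewrite !mem_trace; exact: inS.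
apply: leq_trans (subset_leq_card sub) _.
rewrite cardsU1 z_notin_trace leq_add2r card_gt0.
by apply/set0Pn; exists i; rewrite inE.
Qed.
End Expansion.

(** * The theorem *)

Lemma exists_sharp_graph (n k l : nat) :
  l < k - 1 -> 1 < l -> l <= n - k ->
  exists G : sgraph, [/\ #|G| = n, chromatic k G, vertex_connected l G
    & #|edge_set G| = 'C(k, 2) + uphalf ((n - k + 1) * l)].
Proof.
move=> lk l1 ln.
have k0 : 0 < k by lia.
have lN : l < (n - k).+1 by lia.
have conH := harary_connected l1 lN.
pose z : harary (n - k) l := ord0.
have [|phi injphi] := injective_labelling (A := neighbours z) k0.
  by apply: leq_trans (leq_harary_degree z) _; lia.
pose G := @expansion _ z k phi.
have chrG : chromatic k G.
  apply: expansion_chromatic => // x _.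
  by apply: leq_ltn_trans (leq_harary_degree x) _; lia.
have conG : vertex_connected l G.
  by apply: expansion_connected => //; lia.
have cG : #|G| = n by rewrite card_expansion card_ord /=; lia.
exists G; split=> //.
have := leq_double_edges lk ln cG chrG conG; rewrite subn1 -double_bin2.
have := leq_harary_edges (n - k) l; rewrite expansion_edges -addn1.
set x := (_ * l); lia.
Qed.

Import Order.TTheory GRing.Theory Num.Theory.
Local Open Scope ring_scope.

Lemma ceil_half (m : nat) : Num.ceil (m%:R / 2%:R : rat) = (uphalf m)%:Z.
Proof.
have le_ceil : Num.ceil (m%:R / 2%:R : rat) <= (uphalf m)%:Z.
  rewrite ceil_le_int ler_pdivrMr // -pmulrn -natrM ler_nat; lia.
have lt_ceil : (uphalf m)%:Z - 1 < Num.ceil (m%:R / 2%:R : rat).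
  rewrite ceil_gt_int rmorphB /= -pmulrn ltrBlDr -ltrBlDr ltr_pdivlMr // mulrBl.
  rewrite ltrBlDr mul1r -natrM -natrD ltr_nat; lia.
by move: (Num.ceil _) le_ceil lt_ceil => c; lia.
Qed.

Theorem theorem1p7 (n k l : nat)
    (hlk : (l < k - 1)%N) (hl : (1 < l)%N) (hln : (l <= n - k)%N) :
  (forall G : sgraph,
     #|G| = n -> chromatic k G -> vertex_connected l G ->
     'C(k, 2)%:R + ((n - k + 1) * l)%:R / 2%:R <= #|edge_set G|%:R :> rat)
  /\
  (exists G : sgraph,
     [/\ #|G| = n, chromatic k G, vertex_connected l G &
         #|edge_set G|%:Z
         = 'C(k, 2)%:Z + Num.ceil (((n - k + 1) * l)%:R / 2%:R : rat)]).
Proof.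
split=> [G cG chrG conG|].
  have := leq_double_edges hlk hln cG chrG conG.
  rewrite subn1 -double_bin2 -muln2 -(ler_nat rat) natrD -muln2 !natrM.
  by rewrite -lerBrDl -mulrBl => le_half; rewrite -lerBrDl ler_pdivrMr // natrM.
have [G [cG chrG conG eG]] := exists_sharp_graph hlk hl hln.
by exists G; split=> //; rewrite eG ceil_half PoszD.
Qed.
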